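(* Let $k>20$ be an integer and let $H$ be a finite group with a normal subgroup $M\neq 1$ such that $H/M\cong A_k$ and the extension $1\to M\to H\to A_k\to 1$ is nonsplit (i.e. $M$ has no complement in $H$). If $H$ embeds in the symmetric group $S_\ell$, then $\ell\ge k(k-1)$. Equivalently, $P(H)\ge k(k-1)$.
   Context: $A_k$, $S_k$ denote the alternating and symmetric groups of degree $k$. For a finite group $H$, $P(H)$ denotes the minimal degree of a faithful permutation representation of $H$. *)

(* Defs.v *)
From mathcomp Require Import all_boot all_fingroup all_solvable.

(* Main.v *)
Require Import Defs.
From mathcomp Require Import all_boot all_fingroup all_solvable.
From mathcomp Require Import all_algebra zify.
Set Implicit Arguments.
Unset Strict Implicit.
Unset Printing Implicit Defensive.
Import GRing.Theory.
Local Open Scope group_scope.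

(* Replace [H] by a minimal supplement [G] of [M], and [M] by [M :&: G], which is
   nontrivial since the extension does not split, and nilpotent by the Frattini
   argument; no proper subgroup of [G] supplements it.  Choose a point which [M]
   does not fix, with stabiliser [S] in [G], and suppose that
   [G : S] < k(k-1).  The orbits of [M] on the [G]-orbit of this point have at
   least two points, so the image of [S] in [A_k] has index less than k(k-1)/2.
   A strengthening of Bochert's theorem shows that this image fixes a point, i.e.
   [S] lies in the preimage [G_1] of a point stabiliser [A_(k-1)].  The core [C]
   of [S] in [G_1] has index at most (k-2)! in [G_1], which is too small for
   [A_(k-1)] to survive in [G_1 / C]; so [M C = G_1], and [C] can be enlarged to a
   normal subgroup of prime index p of [G_1], with conjugates [C_i].

   This makes [G] act monomially on k points over Z/p.  If the image of [M]
   consists of constant vectors, lifts of double transpositions satisfying a braid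
   relation generate together with [C_1] a proper supplement of [M].  Otherwise
   the image of [M] contains all differences of unit vectors, and as [G] is
   perfect its elements with trivial coordinates form a proper supplement. *)

(** * 3-cycles and the even permutations that they generate *)

Section Cycles.

Variable T : finType.
Implicit Types (s g h : {perm T}) (x y z d u : T) (X : {set T}) (Y : {group {perm T}}).

(** Products of permutations act from left to right, so for distinct points this is the cycle
    [x -> y -> z -> x]. *)
Definition cyc3 x y z : {perm T} := tperm x y * tperm x z.

Lemma cyc3_1 x y z : y != x -> y != z -> cyc3 x y z x = y.
Proof. by move=> yx yz; rewrite permM tpermL tpermD // eq_sym. Qed.

Lemma cyc3_2 x y z : cyc3 x y z y = z.
Proof. by rewrite permM tpermR tpermL. Qed.

Lemma cyc3_3 x y z : x != z -> y != z -> cyc3 x y z z = x.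
Proof. by move=> xz yz; rewrite permM (tpermD xz yz) tpermR. Qed.

Lemma cyc3_D x y z u : u != x -> u != y -> u != z -> cyc3 x y z u = u.
Proof. by move=> ux uy uz; rewrite permM !tpermD // eq_sym. Qed.

Lemma cyc3J x y z s : cyc3 x y z ^ s = cyc3 (s x) (s y) (s z).
Proof. by rewrite conjMg !tpermJ. Qed.

Lemma cyc3_rot x y z : x != y -> x != z -> y != z -> cyc3 x y z = cyc3 y z x.
Proof.
move=> xy xz yz; apply/permP => u; have [->|ux] := eqVneq u x.
  by rewrite cyc3_1 1?cyc3_3 1?[y == x]eq_sym // [z == x]eq_sym.
have [->|uy] := eqVneq u y; first by rewrite cyc3_2 cyc3_1 // eq_sym.
have [->|uz] := eqVneq u z; first by rewrite cyc3_3 // cyc3_2.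
by rewrite !cyc3_D.
Qed.

Lemma cyc3V x y z : (cyc3 x y z)^-1 = cyc3 x z y.
Proof. by rewrite invMg !tpermV. Qed.

Lemma even_cyc3 x y z : x != y -> x != z -> cyc3 x y z \in 'Alt_T.
Proof. by move=> xy xz; rewrite Alt_even odd_permM !odd_tperm xy xz. Qed.

Lemma perm_on_cyc3 X x y z :
  x \in X -> y \in X -> z \in X -> perm_on X (cyc3 x y z).
Proof.
by move=> xX yX zX; apply: perm_onM; apply: subset_trans (tperm_on _ _) _;
  rewrite subUset !sub1set xX ?yX ?zX.
Qed.

(** The supports of [g] and [h] meet only in [d], so [h] fixes [g d] and [g] fixes [h d]; away from
    [d], [g d] and [h d] the two maps do not interact and the commutator is trivial. *)
Lemma commg_cyc3 g h d :
  (forall x, x != d -> g x = x \/ h x = x) -> g d != d -> h d != d ->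
  [~ g, h] = cyc3 d (h d) (g d) /\ g d != h d.
Proof.
move=> gh gd hd.
have gdh : h (g d) = g d.
  by case: (gh _ gd) => // /perm_inj e; rewrite e eqxx in gd.
have hdg : g (h d) = h d.
  by case: (gh _ hd) => // /perm_inj e; rewrite e eqxx in hd.
have gd1 : g^-1 d != d by apply: contra gd => /eqP e; rewrite -{1}e permKV.
have hd1 : h^-1 d != d by apply: contra hd => /eqP e; rewrite -{1}e permKV.
have ghd : g d != h d.
  by apply/negP => /eqP e; move: hd; rewrite e in gdh; rewrite (perm_inj gdh) eqxx.
split=> //; apply/permP => u.
have E v : h v = v -> h^-1 v = v by move=> e; apply: (perm_inj (s := h)); rewrite permKV.
have E' v : g v = v -> g^-1 v = v by move=> e; apply: (perm_inj (s := g)); rewrite permKV.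
have -> : [~ g, h] u = h (g (h^-1 (g^-1 u))) by rewrite commgEl conjgE !permM.
have [->|ud] := eqVneq u d.
  rewrite cyc3_1 // 1?eq_sym // E ?permKV //.
  by case: (gh _ gd1); rewrite ?permKV // => e; rewrite -e eqxx in gd1.
have [->|uh] := eqVneq u (h d).
  by rewrite cyc3_2 (E' _ hdg) permK gdh.
have [->|ug] := eqVneq u (g d).
  rewrite cyc3_3 1?[h d == _]eq_sym // 1?eq_sym // permK.
  by case: (gh _ hd1) => [->|e]; [rewrite permKV | rewrite permKV in e; rewrite -e eqxx in hd1].
rewrite cyc3_D //.
have [eg|ng] := eqVneq (g u) u.
  rewrite (E' _ eg).
  have nd : h^-1 u != d by apply: contra uh => /eqP <-; rewrite permKV.
  by case: (gh _ nd) => [->|e]; [rewrite permKV | rewrite permKV in e; rewrite -e eg {1}e permKV].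
have nd : g^-1 u != d by apply: contra ug => /eqP <-; rewrite permKV.
have hu : h u = u by case: (gh _ ud) => // e; rewrite e eqxx in ng.
rewrite E ?permKV //; case: (gh _ nd) => //; rewrite permKV => e.
by rewrite {1}e permKV eqxx in ng.
Qed.

(** Induction on the number of moved points; an even permutation cannot move exactly two points, so
    a third moved point is available for a 3-cycle. *)
Lemma cyc3_even_gen X Y s :
  (forall x y z, x \in X -> y \in X -> z \in X ->
     x != y -> x != z -> y != z -> cyc3 x y z \in Y) ->
  perm_on X s -> s \in 'Alt_T -> s \in Y.
Proof.
move=> XY; have [n] := ubnP #|[set x | s x != x]|.
elim: n s => // n IHn s le_n sX s_even.
have [a /eqP sa|s1] := pickP (fun x => s x != x); last first.
  suff -> : s = 1 by apply: group1.
  by apply/permP => x; rewrite perm1; move/eqP: (negbFE (s1 x)).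
have aX : a \in X by apply: (subsetP sX); apply/eqP.
have /eqP sab := sa; set b := s a in sab.
have bb : s b != b by rewrite (inj_eq perm_inj).
have bX : b \in X by apply: (subsetP sX).
have [z /and3P[za zb zz]|no_z] := pickP (fun z => [&& z != a, z != b & s z != z]).
  have zX : z \in X by apply: (subsetP sX).
  (* [q] sends [b = s a] back to [a], so [s * q] fixes [a], and it moves no point that [s] fixes. *)
  pose q := cyc3 b a z.
  have qY : q \in Y by apply: XY; rewrite // eq_sym.
  have qA : q \in 'Alt_T by apply: even_cyc3; rewrite // eq_sym.
  rewrite -(groupMr _ qY); apply: IHn; last by rewrite groupM.
    rewrite -ltnS; apply: leq_trans le_n; rewrite ltnS; apply: proper_card; apply/properP; split.
      apply/subsetP => u; rewrite !inE permM; apply: contra => /eqP su.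
      by rewrite su cyc3_D //; apply/negP => /eqP e; move: su sa bb zz;
        rewrite e => su; rewrite ?su ?eqxx.
    exists a; first by rewrite inE; apply/eqP.
    by rewrite inE permM -/b cyc3_1 ?eqxx // eq_sym.
  by apply: perm_onM => //; apply: perm_on_cyc3.
have eb : s b = a.
  have ssb : s (s b) != s b by rewrite (inj_eq perm_inj).
  by move: (no_z (s b)); rewrite bb ssb !andbT => /negbFE/eqP.
suff e : s = tperm a b.
  by move: s_even; rewrite Alt_even e odd_tperm eq_sym sab.
apply/permP => u; have [->|ua] := eqVneq u a; first by rewrite tpermL.
have [->|ub] := eqVneq u b; first by rewrite tpermR.
move: (no_z u); rewrite ua ub /= => /negbFE/eqP ->.
by rewrite tpermD // eq_sym.
Qed.

End Cycles.

(** * Estimates for binomial coefficients and factorials *)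

Lemma leq_bin_mid n m j : m <= j -> j + m <= n -> 'C(n, m) <= 'C(n, j).
Proof.
suff low i : m <= i -> i.*2 <= n -> 'C(n, m) <= 'C(n, i).
  move=> mj jmn; have [jn|nj] := leqP j.*2 n; first exact: low.
  by rewrite -(bin_sub (m := j)); [apply: low; lia | lia].
elim: i => [|i IHi]; first by rewrite leqn0 => /eqP ->.
rewrite leq_eqVlt => /predU1P[-> //|]; rewrite ltnS => mi ni.
have ii : 'C(n, m) <= 'C(n, i) by apply: IHi => //; lia.
apply: leq_trans ii _; rewrite -(leq_pmul2l (m := i.+1)) // mul_bin_left.
by rewrite leq_mul2r; lia.
Qed.

(** For use with a set of at least two thirds of more than 20 points and at most [2 * c] points:
    this forces [k <= 3 * c] and [6 < c]. *)
Lemma fact_geq_quadratic c k : 6 < c -> k <= 3 * c -> k * k.-1 <= c`!.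
Proof.
move=> c7 kc; apply: (@leq_trans (3 * c * (3 * c))).
  by apply: leq_mul => //; lia.
elim: c c7 {k kc} => // c IHc; rewrite ltnS leq_eqVlt => /predU1P[<- //|c6].
have := IHc c6; rewrite factS; move: c`! => f; nia.
Qed.

(** Here [q] will count disjoint blocks of size [a]. If [k < 2a] there is at most one block and
    ['C(k, 2)] is a lower bound; otherwise [a * 'C(k, a) = k * 'C(k.-1, a.-1)], and ['C(k.-1, 3)]
    bounds the last factor from below. *)
Lemma bin_gt_pairs k a q :
  20 < k -> 3 < a -> a.+2 <= k -> q * a <= k -> q * (k * k.-1) <= 2 * 'C(k, a).
Proof.
move=> k20 a3 ak qa; have [ka|ka] := ltnP k a.*2.
  have q1 : q <= 1 by nia.
  apply: leq_trans (_ : k * k.-1 <= _); first by nia.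
  have := @leq_bin_mid k 2 a; have := mul_bin_left k 1; rewrite bin1; lia.
have C3 : 'C(k.-1, 3) <= 'C(k.-1, a.-1) by apply: leq_bin_mid; lia.
have D1 : (k * 'C(k.-1, a.-1) = a * 'C(k, a))%N by rewrite mul_bin_diag prednK; lia.
have := mul_bin_left k.-1 2; have := mul_bin_left k.-1 1; rewrite bin1 => E2 E3.
move: C3 D1 E2 E3; set A := 'C(k.-1, 3); set B := 'C(k.-1, a.-1).
set C := 'C(k, a); set D := 'C(k.-1, 2) => C3 D1 E2 E3.
have H1 : q * a * (k * k.-1) <= k * (k * k.-1) by rewrite leq_mul2r qa orbT.
have H2 : k * k.-1 <= 2 * A.
  have [n kn] : exists n, k = n.+3 by exists (k - 3); lia.
  have n18 : 17 < n by lia.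
  have E2' : (2 * D = n.+1 * n.+2)%N by rewrite E2 kn /= subn1.
  have E3' : (3 * A = n * D)%N by rewrite E3 kn /= subn2.
  have E6 : (6 * A = n * n.+1 * n.+2)%N by rewrite -mulnA -E2' mulnCA -E3' mulnA.
  rewrite -(leq_pmul2l (m := 3)) // [leqRHS]mulnA E6 kn /= mulnA leq_mul2r.
  by apply/orP; right; clear -n18; nia.
rewrite -(leq_pmul2l (m := a)); last lia.
rewrite mulnA (mulnC a q); apply: leq_trans H1 _.
by rewrite [leqRHS]mulnCA -D1 [leqRHS]mulnCA leq_mul2l (leq_trans H2) ?orbT // leq_mul2l C3 orbT.
Qed.

(** * Orbit lengths, and the action on subsets *)

Lemma orbit_index_bound (gT : finGroupType) (G Y : {group gT}) (S : finType)
    (to : {action gT &-> S}) (x : S) :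
  Y \subset G -> #|orbit to G x| * #|Y| <= #|orbit to Y x| * #|G|.
Proof.
move=> YG; rewrite -[#|Y|](card_orbit_stab to Y x) -(card_orbit_stab to G x).
rewrite mulnCA leq_mul2l leq_mul2l.
by rewrite subset_leq_card ?orbT // setSI.
Qed.

Lemma perm_imset_eq (T : finType) (A B : {set T}) :
  #|A| = #|B| -> exists s : {perm T}, s @: A = B.
Proof.
have [n] := ubnP #|A :\: B|; elim: n A => // n IHn A le_n AB.
have AB' := cardsID B A; have BA' := cardsID A B; rewrite setIC in BA'.
have [e|[x]] := set_0Vmem (A :\: B).
  exists 1; rewrite (eq_imset _ (@perm1 _)) imset_id.
  by apply/eqP; rewrite eqEcard AB leqnn andbT -setD_eq0 e.
rewrite inE => /andP[xB xA].
have [e|[y]] := set_0Vmem (B :\: A).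
  have : 0 < #|A :\: B| by apply/card_gt0P; exists x; rewrite inE xB.
  by rewrite e cards0 in BA'; lia.
rewrite inE => /andP[yA yB].
have [||s sB] := IHn (tperm x y @: A); last first.
- by exists (tperm x y * s); rewrite -sB -imset_comp; apply: eq_imset => u; rewrite permM.
- by rewrite card_imset //; apply: perm_inj.
rewrite -ltnS; apply: leq_trans le_n; rewrite ltnS.
apply: proper_card; apply/properP; split; last first.
  exists x; rewrite !inE xB // andbC; apply/negP => /andP[/imsetP[u uA]].
  move=> e; have uy : u = y by apply: (@perm_inj _ (tperm x y)); rewrite -e tpermR.
  by rewrite uy (negPf yA) in uA.
apply/subsetP => u; rewrite !inE => /andP[uB /imsetP[v vA e]]; rewrite uB /=.
by case: tpermP e => [_ e|_ ->|_ _ ->] //; rewrite e yB in uB.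
Qed.

(** An odd permutation carrying [A] to [B] becomes even after a transposition of two points of
    [A]. *)
Lemma orbit_Alt_subset (T : finType) (A : {set T}) :
  1 < #|A| -> #|orbit 'P^* 'Alt_T A| = 'C(#|T|, #|A|).
Proof.
move=> A2; rewrite -card_draws; apply: eq_card => B; rewrite inE.
apply/orbitP/eqP => [[s _ <-]|BA]; first by rewrite card_setact.
have [s sA] := perm_imset_eq (esym BA).
case/card_gt1P: A2 => x [y [xA yA xy]].
have [e|o] := boolP (s \in 'Alt_T).
  by exists s => //; rewrite setactE -sA.
exists (tperm x y * s).
  by move: o; rewrite !Alt_even odd_permM odd_tperm xy; case: (odd_perm s).
rewrite actM; have -> : 'P^*%act A (tperm x y) = A.
  apply: im_perm_on; apply: subset_trans (tperm_on _ _) _.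
  by rewrite subUset !sub1set xA.
by rewrite -sA.
Qed.

(** * Subgroups of small index in the alternating group *)

Section Bochert.

Variables (T : finType) (Y : {group {perm T}}).

(* Bochert's argument, applied to a largest subset [A] of [X] such that no
   nontrivial element of [Y] is supported in [A].  If [A] were smaller than
   [X :\: A], maximality would give nontrivial elements of [Y] supported in
   [X :\: A] and in [d |: A] with [d] as only common moved point, and their
   commutator is a 3-cycle. *)
Lemma cyc3_free_bound (X : {set T}) :
  (forall x y z, x \in X -> y \in X -> z \in X ->
     x != y -> x != z -> y != z -> cyc3 x y z \notin Y) ->
  exists2 c, #|X| <= 2 * c & #|Y| * c`! <= #|T|`!.
Proof.
move=> freeX.
pose P (A : {set T}) := (A \subset X) && (Y :&: perm.Sym A == 1).
have P0 : P set0.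
  rewrite /P sub0set; apply/eqP/trivgP/subsetP => s /setIP[_]; rewrite !inE => s0.
  by rewrite (perm_on_id s0) ?cards0.
case: (arg_maxnP (fun A : {set T} => #|A|) P0) => /= A /andP[AX /eqP YA] maxA.
exists #|A|; last first.
  (* [Y] and the symmetric group on [A] meet trivially, so their product set has [#|Y| * c!]
     elements. *)
  rewrite -(perm.card_Sym A) -(TI_cardMg YA) -card_Sym.
  by apply: subset_leq_card; apply/subsetP=> s; rewrite inE.
rewrite leqNgt; apply/negP => ltAX.
pose B := X :\: A.
have cB : #|X| = #|A| + #|B| by rewrite -(cardsID A X) (setIidPr AX).
have nontriv (D : {set T}) : D \subset X -> #|A| < #|D| ->
    exists s, [/\ s \in Y, perm_on D s & s != 1].
  move=> DX AD; have : ~~ P D by apply: contraL AD => /maxA; rewrite leqNgt.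
  rewrite /P DX /= -subG1 => /subsetPn[s /setIP[sY]]; rewrite !inE => sD s1.
  by exists s.
have [|g [gY gB g1]] := nontriv B (subsetDl _ _); first by lia.
have [d /eqP gd|g_id] := pickP (fun x => g x != x); last first.
  by case/eqP: g1; apply/permP => x; rewrite perm1; move/eqP: (negbFE (g_id x)).
have dB : d \in B by apply: (subsetP gB); apply/eqP.
have [dA dX] : d \notin A /\ d \in X by move: dB; rewrite inE => /andP[].
have [||h [hY hA h1]] := nontriv (d |: A).
- by rewrite subUset sub1set dX.
- by rewrite cardsU1 dA add1n.
have hd : h d != d.
  apply: contra h1 => /eqP hd; have <- : (h \in Y :&: perm.Sym A) = (h == 1) by rewrite YA inE.
  rewrite inE hY inE.
  apply/subsetP => x; rewrite inE => hx.
  have := subsetP hA x hx; rewrite !inE => /orP[/eqP e|//].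
  by rewrite e hd eqxx in hx.
have [||e ne] := @commg_cyc3 _ g h d _ _ hd; [|exact/eqP|].
  move=> x xd; have [xA|xA] := boolP (x \in A).
    by left; apply: (out_perm gB); rewrite inE xA.
  by right; apply: (out_perm hA); rewrite !inE negb_or xd.
have BX : {subset B <= X} by apply/subsetP/subsetDl.
have gdX : g d \in X by apply: BX; rewrite perm_closed.
have hdX : h d \in X.
  have : h d \in d |: A by rewrite perm_closed // setU11.
  by rewrite !inE => /orP[/eqP ->//|/(subsetP AX)].
have := freeX d (h d) (g d) dX hdX gdX; rewrite -e groupR //.
by rewrite 1?eq_sym hd 1?[d == _]eq_sym 1?[_ == g d]eq_sym ne; move/eqP: gd => -> /(_ isT isT isT).
Qed.

Definition cyc3_rel x y :=
  (x == y) || [exists z, [&& z != x, z != y & cyc3 x y z \in Y]].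

Lemma cyc3_memV x y z : (cyc3 x z y \in Y) = (cyc3 x y z \in Y).
Proof. by rewrite -groupV cyc3V. Qed.

Lemma cyc3_mem_rot x y z : x != y -> x != z -> y != z ->
  (cyc3 y z x \in Y) = (cyc3 x y z \in Y).
Proof. by move=> xy xz yz; rewrite [cyc3 x y z]cyc3_rot. Qed.

Lemma cyc3_mem_swap x y z : x != y -> x != z -> y != z ->
  (cyc3 y x z \in Y) = (cyc3 x y z \in Y).
Proof. by move=> xy xz yz; rewrite cyc3_memV cyc3_mem_rot. Qed.

Lemma cyc3_mem_rev x y z : x != y -> x != z -> y != z ->
  (cyc3 z y x \in Y) = (cyc3 x y z \in Y).
Proof.
by move=> xy xz yz; rewrite cyc3_memV -cyc3_mem_rot 1?eq_sym // 1?eq_sym //.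
Qed.

Lemma cyc3_relP x y : x != y ->
  reflect (exists z, [/\ z != x, z != y & cyc3 x y z \in Y]) (cyc3_rel x y).
Proof.
move=> xy; rewrite /cyc3_rel (negPf xy) /=.
by apply: (iffP existsP) => -[z]; [case/and3P | case]; exists z => //; apply/and3P.
Qed.

Lemma cyc3_rel_sym x y : cyc3_rel x y = cyc3_rel y x.
Proof.
suff {x y} H x y : cyc3_rel x y -> cyc3_rel y x by apply/idP/idP; apply: H.
have [->//|xy] := eqVneq x y; have yx : y != x by rewrite eq_sym.
case/cyc3_relP => // z [zx zy zY]; apply/cyc3_relP => //; exists z; split=> //.
by rewrite cyc3_mem_swap // eq_sym.
Qed.

(** Conjugating the first 3-cycle by the second gives [cyc3 z y x]. *)
Lemma cyc3_mem_merge x y z u : uniq [:: x; y; z; u] ->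
  cyc3 x y u \in Y -> cyc3 x z u \in Y -> cyc3 x y z \in Y.
Proof.
rewrite /= !inE !negb_or !andbT => /and3P[/and3P[xy xz xu] /andP[yz yu] zu] Yy Yz.
have [yx zx] : y != x /\ z != x by rewrite ![_ == x]eq_sym.
by have := groupJ Yy Yz; rewrite cyc3J cyc3_1 // cyc3_3 // cyc3_D // cyc3_mem_rev.
Qed.

(** Related points share some 3-cycle of [Y]; this makes the third point free, whence transitivity,
    and all 3-cycles inside a class lie in [Y]. *)
Lemma cyc3_rel_mem x y z : x != y -> x != z -> y != z ->
  cyc3_rel x y -> cyc3_rel x z -> cyc3 x y z \in Y.
Proof.
move=> xy xz yz /(cyc3_relP xy)[u [ux uy Yu]] /(cyc3_relP xz)[v [vx vz Yv]].
have zy : z != y by rewrite eq_sym.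
have [<-//|uz] := eqVneq u z.
have [e|vy] := eqVneq v y.
  by rewrite cyc3_memV -e.
have [e|uv] := eqVneq u v.
  apply: (@cyc3_mem_merge _ _ _ u) => //; last by rewrite e.
  by rewrite /= !inE !negb_or xy xz yz !(eq_sym _ u) ux uy uz.
(* With [u] and [v] distinct, conjugation turns [cyc3 x y u] into [cyc3 z y u], and the merging
   lemma then applies at [y]. *)
have := groupJ Yu Yv; rewrite cyc3J cyc3_1 // 1?eq_sym // !cyc3_D // 1?eq_sym // => Yzyu.
rewrite -cyc3_mem_swap //; apply: (@cyc3_mem_merge _ _ _ u).
- by rewrite /= !inE !negb_or [y == x]eq_sym xy xz yz !(eq_sym _ u) ux uy uz.
- by rewrite cyc3_mem_swap // eq_sym.
by rewrite -cyc3_mem_swap // eq_sym.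
Qed.

Lemma cyc3_rel_trans : transitive cyc3_rel.
Proof.
move=> y x z; have [->//|xy] := eqVneq x y; have [->//|yz] := eqVneq y z.
have [->|xz] := eqVneq x z; first by rewrite /cyc3_rel eqxx.
rewrite cyc3_rel_sym => yx yz'; apply/cyc3_relP => //; exists y.
rewrite [y == x]eq_sym xy yz; split=> //.
by rewrite cyc3_memV -cyc3_mem_swap // cyc3_rel_mem // eq_sym.
Qed.

Lemma cyc3_rel_perm s x y : s \in Y -> cyc3_rel (s x) (s y) = cyc3_rel x y.
Proof.
suff {s x y} H s x y : s \in Y -> cyc3_rel x y -> cyc3_rel (s x) (s y).
  move=> sY; apply/idP/idP; last exact: H.
  by have := H s^-1 (s x) (s y); rewrite !permK groupV => /(_ sY) H1 /H1.
move=> sY; have [->|xy] := eqVneq x y; first by rewrite /cyc3_rel !eqxx.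
case/cyc3_relP => // z [zx zy zY]; apply/cyc3_relP; first by rewrite (inj_eq perm_inj).
by exists (s z); rewrite !(inj_eq perm_inj) -cyc3J groupJ.
Qed.

End Bochert.

Section SmallIndex.

Variables (T : finType) (Y : {group {perm T}}).
Hypothesis T20 : 20 < #|T|.
(** For [Y] inside the alternating group, of order half of [#|T|!], this says that its index is less
    than [k(k-1)/2], where [k = #|T|]. *)
Hypothesis Ybig : #|T|`! < #|T| * #|T|.-1 * #|Y|.

Let cls x := [set y | cyc3_rel Y x y].

Let cls_refl x : x \in cls x.
Proof. by rewrite inE /cyc3_rel eqxx. Qed.

Let cls_eq x y : y \in cls x -> cls y = cls x.
Proof.
rewrite inE => xy; apply/setP => z; rewrite !inE; apply/idP/idP.
  exact: cyc3_rel_trans.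
by apply: cyc3_rel_trans; rewrite cyc3_rel_sym.
Qed.

(* If all classes had at most three points, numbering the points of each class
   by 0, 1, 2 and removing the least used number would leave two thirds of all
   points, and no 3-cycle of [Y] among them. *)
Lemma large_cyc3_class : exists x, 3 < #|cls x|.
Proof.
case: (boolP [exists x, 3 < #|cls x|]) => [/existsP //|/existsPn small]; exfalso.
(* The position of [x] within its class. *)
pose rk x := #|[set y in cls x | enum_rank y < enum_rank x]|.
have rk_lt x y : cyc3_rel Y x y -> enum_rank x < enum_rank y -> rk x < rk y.
  move=> xy ltxy; apply: proper_card; apply/properP; split.
    apply/subsetP => z; rewrite !inE => /andP[xz ltzx].
    by rewrite (ltn_trans ltzx ltxy) andbT; apply: cyc3_rel_trans xz; rewrite cyc3_rel_sym.
  by exists x; rewrite inE ?ltnn ?andbF // inE cyc3_rel_sym xy.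
have rk_neq x y : cyc3_rel Y x y -> x != y -> rk x != rk y.
  move=> xy; apply: contraNneq => rkxy; apply/eqP/enum_rank_inj/ord_inj.
  have := rk_lt _ _ xy; have := rk_lt y x; rewrite cyc3_rel_sym => /(_ xy); lia.
have rk3 x : rk x < 3.
  apply: leq_trans (_ : #|cls x| <= _); last by rewrite leqNgt small.
  apply: proper_card; apply/properP; split; last by exists x; rewrite // inE ltnn andbF.
  by apply/subsetP => y; rewrite inE => /andP[].
have [j j3 Xj] : exists2 j, j < 3 & 3 * #|[set x | rk x == j]| <= #|T|.
  have [F FE] : {F | forall j, F j = #|[set x | rk x == j]|} by eexists.
  have : (#|T| = \sum_(j < 3) F j)%N.
    rewrite -sum1_card (partition_big (fun x => Ordinal (rk3 x)) xpredT) //=.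
    apply: eq_bigr => j _; rewrite FE -sum1_card; apply: eq_bigl => x.
    by rewrite inE -val_eqE.
  rewrite -(big_mkord xpredT F) !big_nat_recr //= big_geq // => sumrk.
  have [j j3 Fj] : exists2 j, j < 3 & 3 * F j <= #|T|; last by exists j; rewrite -?FE.
  rewrite {}sumrk; have [?|?] := leqP (2 * F 0) (F 1%N + F 2)%N; first by exists 0; lia.
  by have [?|?] := leqP (2 * F 1%N) (F 0 + F 2)%N; [exists 1%N; lia | exists 2; lia].
have [x y z|c cX cY] := @cyc3_free_bound T Y (~: [set x | rk x == j]).
  rewrite !inE => rx ry rz xy xz yz; apply/negP => xyzY.
  have Rxy : cyc3_rel Y x y by apply/(cyc3_relP _ xy); exists z; rewrite ![z == _]eq_sym.
  have Ryz : cyc3_rel Y y z.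
    by apply/(cyc3_relP _ yz); exists x; rewrite xy xz cyc3_mem_rot.
  have Rxz := cyc3_rel_trans Rxy Ryz.
  have [rxy rxz ryz] := And3 (rk_neq _ _ Rxy xy) (rk_neq _ _ Rxz xz) (rk_neq _ _ Ryz yz).
  have [{}rx3 ry3 rz3] := And3 (rk3 x) (rk3 y) (rk3 z).
  by move: (rk x) (rk y) (rk z) rx ry rz rxy rxz ryz rx3 ry3 rz3 => a b c; clear -j3; lia.
have cT := cardsC [set x | rk x == j].
have := @fact_geq_quadratic c #|T|; move: cY Ybig; move: #|T|`! => F.
(* The remaining two thirds of [T] have at most [2 * c] points, so [#|T| <= 3 * c], and [20 < #|T|]
   gives [7 <= c]. *)
move=> cY Y' H; have /H {H} : 6 < c by lia.
have kc : #|T| <= 3 * c by lia.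
move/(_ kc) => H; have : #|T| * #|T|.-1 * #|Y| <= c`! * #|Y| by rewrite leq_mul2r H orbT.
by lia.
Qed.

(** Take a largest class, of size [a]. If it is all of [T], all even permutations lie in [Y]; if it
    misses one point, [Y] fixes that point. Otherwise its translates under [Y] are [q] disjoint sets
    with [q * a <= k], while its orbit under the alternating group has length ['C(k, a)], and the
    index of [Y] is too large. *)
Lemma small_index_Alt :
  Y \subset 'Alt_T -> Y = 'Alt_T :> {set _} \/ exists x, forall y, y \in Y -> y x = x.
Proof.
move=> YA; have [x0 x0_big] := large_cyc3_class.
case: (arg_maxnP (fun x => #|cls x|) (isT : xpredT x0)) => /= x _ maxx.
have {x0_big} big := leq_trans x0_big (maxx x0 isT).
have cls_cyc3 a b c : a \in cls x -> b \in cls x -> c \in cls x ->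
    a != b -> a != c -> b != c -> cyc3 a b c \in Y.
  move=> /cls_eq ax bx cx ab ac bc.
  by move: bx cx; rewrite -ax !inE; apply: cyc3_rel_mem.
have cls_act y s : s \in Y -> s @: cls y = cls (s y).
  move=> sY; apply/setP => z; rewrite -[z](permKV s) mem_imset; last exact: perm_inj.
  by rewrite !inE cyc3_rel_perm.
have le_clsT : #|cls x| <= #|T| by apply: max_card.
have [clsT|nclsT] := eqVneq #|cls x| #|T|.
  left; apply/eqP; rewrite eqEsubset YA; apply/subsetP => s sA.
  have eT : cls x = setT by apply/eqP; rewrite eqEcard subsetT cardsT clsT /=.
  apply: (cyc3_even_gen (X := setT)) => //; last by apply/subsetP => u; rewrite !inE.
  by move=> a b c _ _ _; apply: cls_cyc3; rewrite eT.
have cC := cardsC (cls x).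
have [cls1|ncls1] := eqVneq #|~: cls x| 1%N.
  right; have /cards1P[z ez] : #|~: cls x| == 1%N by apply/eqP.
  (* If [s] moved [x] to [z], the class of [z] would have more than three points within a one-point
     complement. *)
  exists z => s sY; have sx : s x \in cls x.
    apply: contraT; rewrite -in_setC ez => /set1P sx.
    have : #|cls z| = #|cls x| by rewrite -sx -cls_act // card_imset //; apply: perm_inj.
    have : cls z \subset ~: cls x.
      apply/subsetP => u uz; rewrite inE; apply/negP => ux.
      have : z \notin cls x by rewrite -in_setC ez set11.
      by rewrite -(cls_eq ux) (cls_eq uz) cls_refl.
    by move/subset_leq_card; rewrite cls1 => ? ?; lia.
  have : s z \in ~: cls x.
    rewrite -(cls_eq sx) -cls_act // inE mem_imset; last exact: perm_inj.
    by rewrite -in_setC ez set11.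
  by rewrite ez => /set1P.
pose O := orbit 'P^* Y (cls x).
have O_cls A : A \in O -> exists y, A = cls y.
  by case/orbitP => s sY <-; exists (s x); rewrite -cls_act.
have cardO A : A \in O -> #|A| = #|cls x| by case/orbitP => s _ <-; rewrite card_setact.
have tiO : trivIset O.
  apply/trivIsetP => A B /O_cls[y ->] /O_cls[z ->]; apply: contraR.
  by case/pred0Pn => u /= /andP[/cls_eq <- /cls_eq <-].
have qa : #|O| * #|cls x| <= #|T|.
  rewrite -(card_uniform_partition (P := O) (D := cover O) cardO).
    exact: max_card.
  apply/and3P; split=> //; apply/negP => /O_cls[y] /setP/(_ y).
  by rewrite cls_refl inE.
have cx2 : (#|cls x|).+2 <= #|T| by lia.
have := orbit_index_bound 'P^* (cls x) YA; rewrite orbit_Alt_subset; last lia.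
have := bin_gt_pairs T20 big cx2 qa; have := @card_Alt T.
rewrite -/O => /(_ ltac:(lia)) cA B1 B2; move: Ybig; rewrite -cA.
move: B1 B2; set a := #|'Alt_T|; set q := #|O|; set C := 'C(_, _); set m := #|Y|.
set kk := (#|T| * #|T|.-1)%N => B1 B2 B3.
have B4 : q * kk * m <= 2 * C * m by rewrite leq_mul2r B1 orbT.
have q0 : 0 < q by rewrite card_gt0; apply/set0Pn; exists (cls x); apply: orbit_refl.
have : q * (2 * a) < q * (kk * m) by rewrite ltn_pmul2l.
lia.
Qed.

End SmallIndex.

(** * Even permutations as products of commutators *)

Lemma fresh_point (T : finType) (s : seq T) : size s < #|T| -> exists x, x \notin s.
Proof.
move=> ltsT; apply/existsP; rewrite -negb_forall; apply: contraL ltsT => /forallP sT.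
by rewrite -leqNgt; apply: leq_trans (card_size s); apply/subset_leq_card/subsetP.
Qed.

(** With five points available, [cyc3 x y z] is the commutator of [cyc3 x z u] and [cyc3 x y v],
    whose supports meet only in [x]. *)
Lemma even_perm_der (T : finType) (X : {set T}) (K : {group {perm T}}) :
  4 < #|X| ->
  (forall x y z, x \in X -> y \in X -> z \in X ->
     x != y -> x != z -> y != z -> cyc3 x y z \in K) ->
  forall s, perm_on X s -> s \in 'Alt_T -> s \in [~: K, K].
Proof.
move=> X5 XK s; apply: cyc3_even_gen => x y z xX yX zX xy xz yz.
have fresh (A : seq T) : size A < 5 -> exists2 u, u \in X & u \notin A.
  move=> A5; apply/subsetPn; apply: contraL X5 => /subset_leq_card XA.
  by rewrite -leqNgt (leq_trans XA) // (leq_trans (card_size A)).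
have [u uX] := fresh [:: x; y; z] isT; rewrite !inE !negb_or => /and3P[ux uy uz].
have [v vX] := fresh [:: x; y; z; u] isT; rewrite !inE !negb_or => /and4P[vx vy vz vu].
have [yx zx] : y != x /\ z != x by rewrite ![_ == x]eq_sym.
have zy : z != y by rewrite eq_sym.
have [|||e _] := @commg_cyc3 _ (cyc3 x z u) (cyc3 x y v) x.
- move=> w wx; have [->|wz] := eqVneq w z; first by right; rewrite cyc3_D // eq_sym.
  have [->|wu] := eqVneq w u; first by right; rewrite cyc3_D // eq_sym.
  by left; rewrite cyc3_D.
- by rewrite cyc3_1 // eq_sym.
- by rewrite cyc3_1 // eq_sym.
rewrite !cyc3_1 // 1?eq_sym // in e; rewrite -e.
by apply: mem_commg; apply: XK => //; rewrite eq_sym.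
Qed.

Lemma Alt_der1 (T : finType) : 4 < #|T| -> [~: 'Alt_T, 'Alt_T] = 'Alt_T.
Proof.
move=> T5; apply/eqP; rewrite eqEsubset commg_subl.
rewrite (subset_trans (Alt_subset T) (Alt_norm T)); apply/subsetP => s sA.
apply: (@even_perm_der T setT 'Alt_T%G) => //; rewrite ?cardsT //.
  by move=> x y z _ _ _ xy xz _; apply: even_cyc3.
by apply/subsetP => u; rewrite !inE.
Qed.

(** * Extensions of the alternating group by a Frattini kernel *)

Definition point_preim (gT : finGroupType) (T : finType) (G : {group gT})
    (phi : {morphism G >-> {perm T}}) (i : T) : {group gT} :=
  (phi @*^-1 'C[i | 'P])%G.

Section CoherentFamily.

Variables (gT : finGroupType) (T : finType) (G M : {group gT}).
Variables (phi : {morphism G >-> {perm T}}) (D : T -> {group gT}).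
Local Notation stab := (point_preim phi).

Hypothesis T9 : 9 < #|T|.
Hypothesis phiG : phi @* G = 'Alt_T.
Hypothesis ker_phi : 'ker phi = M.
Hypothesis Frattini : forall U : {group gT}, U \subset G -> M * U = G -> M \subset U.
Hypothesis DJ : forall h i, h \in G -> D i :^ h = D (phi h i).
Hypothesis DstabS : forall i, D i \subset stab i.
Hypothesis Dprime : forall i, prime #|stab i : D i|.
Hypothesis MD : forall i, ~~ (M \subset D i).

Lemma mem_stab h i : (h \in stab i) = (h \in G) && (phi h i == i).
Proof.
rewrite inE; case hG: (h \in G) => //=.
by rewrite inE; apply/astab1P/eqP.
Qed.

Lemma kernel_sub : M \subset G.
Proof. by rewrite -ker_phi subsetIl. Qed.

Lemma mem_kernel h : (h \in M) = (h \in G) && (phi h == 1).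
Proof.
rewrite -ker_phi; apply/idP/andP => [hM|[hG /eqP h1]]; last exact/kerP.
by rewrite (mker hM) eqxx (subsetP (subsetIl _ _) _ hM).
Qed.

Lemma family_sub i : D i \subset G.
Proof. by apply/subsetP => h /(subsetP (DstabS i)); rewrite mem_stab => /andP[]. Qed.

Lemma familyJ h i x : h \in G -> (x ^ h \in D (phi h i)) = (x \in D i).
Proof. by move=> hG; rewrite -DJ // memJ_conjg. Qed.

Lemma kernel_stab i : M \subset stab i.
Proof.
by apply/subsetP => h; rewrite mem_kernel mem_stab => /andP[-> /eqP ->]; rewrite perm1 eqxx.
Qed.

Lemma family_normal i : D i <| stab i.
Proof.
rewrite /normal DstabS; apply/subsetP => h; rewrite mem_stab inE => /andP[hG /eqP hi].
by rewrite DJ // hi.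
Qed.

Lemma Dder i : [~: stab i, stab i] \subset D i.
Proof.
apply: der1_min (normal_norm (family_normal i)) _; apply: cyclic_abelian.
rewrite prime_cyclic // card_quotient ?normal_norm ?family_normal //; exact: Dprime.
Qed.

(** [D i] is normal of prime index, hence maximal, and [M] is not inside it. *)
Lemma Dlift i : stab i \subset M * D i.
Proof.
have nDM : M \subset 'N(D i) := subset_trans (kernel_stab i) (normal_norm (family_normal i)).
rewrite (normC nDM).
have maxD := p_index_maximal (DstabS i) (Dprime i).
by rewrite (mulg_normal_maximal (family_normal i) maxD (kernel_stab i)) ?MD.
Qed.

Lemma phi_Alt h : h \in G -> phi h \in 'Alt_T.
Proof. by move=> hG; rewrite -phiG mem_morphim. Qed.

Lemma lift_Alt s : s \in 'Alt_T -> exists2 h, h \in G & phi h = s.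
Proof. by rewrite -phiG => /morphimP[h hG _ ->]; exists h. Qed.

Lemma lift_family s i : s \in 'Alt_T -> s i = i -> exists2 h, h \in D i & phi h = s.
Proof.
move=> /lift_Alt[h hG <-] hi.
have : h \in stab i by rewrite mem_stab hG hi eqxx.
case/(subsetP (Dlift i))/mulsgP => m d mM dD ->; exists d => //.
have dG := subsetP (family_sub i) _ dD.
move: mM; rewrite mem_kernel => /andP[mG /eqP m1].
by rewrite morphM // m1 mul1g.
Qed.

Lemma kernel_quotient h k : h \in G -> k \in G -> phi h = phi k -> h * k^-1 \in M.
Proof.
by move=> hG kG hk; rewrite mem_kernel groupM ?groupV //= morphM ?groupV // morphV // hk mulgV.
Qed.

(** The alternating group is perfect, so the derived subgroup supplements [M] and therefore contains
    it. *)
Lemma perfect_group : [~: G, G] = G.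
Proof.
have GG : [~: G, G] \subset G by rewrite commg_subl normG.
have MG : M * [~: G, G] = G.
  apply/eqP; rewrite eqEsubset mul_subG ?kernel_sub //=; apply/subsetP => h hG.
  have := phi_Alt hG; rewrite -Alt_der1 ?(leq_trans _ T9) // -phiG -morphimR //.
  case/morphimP => k kG kD hk; rewrite -(mulgKV k h); apply: mem_mulg => //.
  exact: kernel_quotient.
have := Frattini GG MG => MGG.
by rewrite -{3}MG mulSGid.
Qed.

(* Here the kernel [M :&: D i] does not depend on [i], so an element of some
   [D i] is determined modulo it by its image in the alternating group.  Lifts
   [t] and [r] of (1 2)(4 5) and (2 3)(4 5) in [D a6] satisfy
   [t r t = r t r] modulo that kernel, and this makes
   [D a1 :|: D a1 * t * D a1] a subgroup, which contradicts [Frattini]. *)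
Lemma kernel_compat_false : (forall i j, M :&: D i \subset D j) -> False.
Proof.
move=> MDD.
(* The image of [h] is an even permutation of the points other than [i] and [j], so it agrees with
   that of some [k] in the derived subgroup of [D i :&: stab j]. Such a [k] lies in [D i] and [D j],
   and [h * k^-1] lies in [M :&: D i]. *)
have DD i j h : i != j -> h \in D i -> phi h j = j -> h \in D j.
  move=> ij hDi hj; have hG := subsetP (family_sub i) _ hDi.
  have /andP[_ /eqP hi] : (h \in G) && (phi h i == i).
    by rewrite -mem_stab (subsetP (DstabS i)).
  pose K := (D i :&: stab j)%G.
  have KG : K \subset G := subset_trans (subsetIl _ _) (family_sub i).
  have : phi h \in [~: phi @* K, phi @* K].
    apply: (@even_perm_der T (~: [set i; j])); last exact: phi_Alt.
    - by have := cardsC [set i; j]; rewrite cards2 ij; lia.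
    - move=> x y z; rewrite !inE !negb_or.
      move=> /andP[xi xj] /andP[yi yj] /andP[zi zj] xy xz yz.
      have [|k kD kE] := @lift_family (cyc3 x y z) i (even_cyc3 xy xz).
        by rewrite cyc3_D // eq_sym.
      rewrite -kE; apply: mem_morphim; first exact: (subsetP (family_sub i)).
      rewrite inE kD mem_stab (subsetP (family_sub i)) //= kE.
      by rewrite cyc3_D // eq_sym.
    - apply/subsetP => x; rewrite !inE; apply: contra.
      by case/orP => /eqP ->; rewrite ?hi ?hj.
  rewrite -morphimR // => /morphimP[k kG kK hk].
  have kDi : k \in D i.
    apply: (subsetP _ _ kK); apply: subset_trans (commgSS (subsetIl _ _) (subsetIl _ _)) _.
    by rewrite commg_subl normG.
  have kDj : k \in D j.
    by apply: (subsetP (Dder j)); apply: (subsetP _ _ kK); apply: commgSS; apply: subsetIr.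
  rewrite -(mulgKV k h) groupM // (subsetP (MDD i j)) // inE kernel_quotient //=.
  by rewrite groupM ?groupV.
have [a1 _] := @fresh_point T [::] (ltac:(by apply: leq_trans T9)).
have [a2] := @fresh_point T [:: a1] (ltac:(by apply: leq_trans T9)).
rewrite !inE => a21.
have [a3] := @fresh_point T [:: a1; a2] (ltac:(by apply: leq_trans T9)).
rewrite !inE !negb_or => /andP[a31 a32].
have [a4] := @fresh_point T [:: a1; a2; a3] (ltac:(by apply: leq_trans T9)).
rewrite !inE !negb_or => /and3P[a41 a42 a43].
have [a5] := @fresh_point T [:: a1; a2; a3; a4] (ltac:(by apply: leq_trans T9)).
rewrite !inE !negb_or => /and4P[a51 a52 a53 a54].
have [a6] := @fresh_point T [:: a1; a2; a3; a4; a5] (ltac:(by apply: leq_trans T9)).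
rewrite !inE !negb_or => /and5P[a61 a62 a63 a64 a65].
have sym (x y : T) : x != y -> y != x by rewrite eq_sym.
pose s1 := tperm a1 a2; pose s2 := tperm a2 a3; pose s := tperm a4 a5.
have s1s : s1 * s = s * s1.
  by rewrite conjgC /s1 tpermJ !tpermD // sym.
have s2s : s2 * s = s * s2.
  by rewrite conjgC /s2 tpermJ !tpermD // sym.
have braid : s1 * s2 * s1 = s2 * s1 * s2.
  have -> : s1 * s2 * s1 = s2 ^ s1 by rewrite conjgE /s1 tpermV mulgA.
  have -> : s2 * s1 * s2 = s1 ^ s2 by rewrite conjgE /s2 tpermV mulgA.
  by rewrite !tpermJ tpermR tpermL !tpermD // 1?sym // tpermC.
have ss : s * s = 1 by rewrite /s tperm2.
have [t tD6 phit] : exists2 t, t \in D a6 & phi t = s1 * s.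
  apply: lift_family; first by rewrite Alt_even odd_permM !odd_tperm (sym _ _ a21) (sym _ _ a54).
  by rewrite permM !tpermD // sym.
have [r rD6 phir] : exists2 r, r \in D a6 & phi r = s2 * s.
  apply: lift_family; first by rewrite Alt_even odd_permM !odd_tperm (sym _ _ a32) (sym _ _ a54).
  by rewrite permM !tpermD // sym.
have tG := subsetP (family_sub _) _ tD6; have rG := subsetP (family_sub _) _ rD6.
have rD1 : r \in D a1.
  by apply: DD rD6 _ => //; rewrite phir permM !tpermD.
have r2 : phi r a2 = a3 by rewrite phir permM tpermL tpermD.
have t1 : phi t a1 = a2 by rewrite phit permM tpermL tpermD.
have t2 : phi t a2 = a1 by rewrite phit permM tpermR tpermD.
have M6 x : x \in D a6 -> phi x = 1 -> x \in D a1.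
  move=> xD x1; apply: (subsetP (MDD a6 a1)); rewrite inE xD mem_kernel x1 eqxx.
  by rewrite (subsetP (family_sub _) _ xD).
have ttD : t * t \in D a1.
  apply: M6; first exact: groupM.
  by rewrite morphM // phit {2}s1s mulgA -(mulgA s1 s s) ss mulg1 tperm2.
have trtD : (t * r * t) * (r * t * r)^-1 \in D a1.
  apply: M6; first by rewrite groupM ?groupV ?groupM.
  rewrite morphM ?groupV ?groupM // morphV ?groupM // !morphM ?groupM // phit phir.
  apply/eqP; rewrite -eq_mulgV1; apply/eqP.
  rewrite !mulgA -[s1 * s * s2]mulgA -s2s mulgA -[_ * s * s]mulgA ss mulg1 braid.
  by rewrite -[s2 * s * s1]mulgA -s1s mulgA -[_ * s * s]mulgA ss mulg1.
pose V := [set c * t * d | c in D a1, d in D a1].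
pose U := D a1 :|: V.
have UD u d : u \in U -> d \in D a1 -> u * d \in U.
  rewrite !inE => /orP[uD|/imset2P[c e cD eD ->]] dD; first by rewrite groupM.
  by apply/orP; right; apply/imset2P; exists c (e * d); rewrite ?groupM ?mulgA.
have DU u d : u \in U -> d \in D a1 -> d * u \in U.
  rewrite !inE => /orP[uD|/imset2P[c e cD eD ->]] dD; first by rewrite groupM.
  by apply/orP; right; apply/imset2P; exists (d * c) e; rewrite ?groupM ?mulgA.
have tU : t \in U.
  by rewrite inE; apply/orP; right; apply/imset2P; exists 1 1; rewrite ?group1 ?mul1g ?mulg1.
have fixD i c : c \in D i -> phi c i = i.
  by move/(subsetP (DstabS i)); rewrite mem_stab => /andP[_ /eqP].
have DG i c : c \in D i -> c \in G by apply: (subsetP (family_sub i)).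
have tDt c : c \in D a2 -> t * c * t^-1 \in D a1.
  by move=> cD; rewrite -(familyJ _ _ tG) t1 conjgE mulgKV mulKg.
have tDt' c : c \in D a2 -> t^-1 * c * t \in D a1.
  by move=> cD; rewrite -mulgA -conjgE -t2 familyJ.
have tct c : c \in D a1 -> t * c * t \in U.
  move=> cD1; have c1 := fixD _ _ cD1; have cG := DG _ _ cD1.
  have [c2|nc2] := eqVneq (phi c a2) a2.
    have cD2 : c \in D a2 by apply: DD cD1 c2; rewrite sym.
    have -> : t * c * t = (t * c * t^-1) * (t * t) by rewrite !mulgA mulgKV.
    by rewrite inE groupM ?tDt.
  set w := phi c a2 in nc2.
  have w1 : w != a1 by rewrite -c1 (inj_eq perm_inj).
  have [d dD1 [d2 d3]] : exists2 d, d \in D a1 & phi d a2 = a2 /\ phi d a3 = w.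
    have [->|w3] := eqVneq w a3; first by exists 1; rewrite ?group1 ?morph1 ?perm1.
    have [z] := @fresh_point T [:: a1; a2; a3; w] (ltac:(by apply: leq_trans T9)).
    rewrite !inE !negb_or => /and4P[z1 z2 z3 zw].
    have [||d dD1 phid] := @lift_family (cyc3 a3 w z) a1.
    - by apply: even_cyc3; rewrite sym.
    - by rewrite cyc3_D // sym.
    by exists d => //; rewrite phid cyc3_1 // ?cyc3_D // sym.
  (* This writes [c = e * r * d] with [e] and [d] in both [D a1] and [D a2]. Conjugation by [t] or
     its inverse takes these two factors into [D a1], and [t * r * t] is [r * t * r] up to a factor
     in [D a1]. *)
  have dG := DG _ _ dD1; pose e := c * d^-1 * r^-1.
  have eD1 : e \in D a1 by rewrite !groupM ?groupV.
  have eD2 : e \in D a2.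
    apply: DD eD1 _; first by rewrite sym.
    by rewrite /e !morphM ?groupM ?groupV // !morphV // !permM -/w -d3 permK -r2 permK.
  have dD2 : d \in D a2 by apply: DD dD1 d2; rewrite sym.
  have -> : t * c * t = (t * e * t^-1) * (t * r * t) * (t^-1 * d * t).
    by rewrite /e !mulgA !(mulgKV, mulgK).
  rewrite -[t * r * t](mulgKV (r * t * r)).
  apply: (UD); [apply: (DU _ _ _ (tDt _ eD2)); apply: (DU _ _ _ trtD) | exact: tDt'].
  by apply: (UD _ _ _ rD1); apply: (DU _ _ _ rD1).
have gU : group_set U.
  apply/group_setP; split=> [|u v uU]; first by rewrite inE group1.
  have ut c : c \in U -> c * t \in U.
    rewrite inE => /orP[cD|/imset2P[c1 c2 c1D c2D ->]]; first exact: (DU).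
    by rewrite -!mulgA; apply: (DU) => //; rewrite mulgA; apply: tct.
  rewrite inE => /orP[vD|/imset2P[c1 c2 c1D c2D ->]]; first exact: (UD).
  by rewrite !mulgA; apply: (UD) => //; apply: ut; apply: (UD).
have UG : U \subset G.
  apply/subsetP => u; rewrite inE => /orP[/DG //|/imset2P[c d /DG cG /DG dG ->]].
  by rewrite !groupM.
have MU : M * U = G.
  apply/eqP; rewrite eqEsubset mul_subG ?kernel_sub //=; apply/subsetP => h hG.
  (* [M * D a1] contains the stabiliser of [a1] and [U] absorbs [D a1], so transitivity of [U] is
     enough. *)
  suff [u uU hu1] : exists2 u, u \in U & phi u a1 = phi h a1.
    have uG := subsetP UG _ uU.
    have : h * u^-1 \in stab a1.
      by rewrite mem_stab groupM ?groupV //= morphM ?groupV // morphV // permM -hu1 permK.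
    case/(subsetP (Dlift a1))/mulsgP => m d mM dD e.
    by rewrite -(mulgKV u h) e -mulgA; apply: mem_mulg => //; apply: (DU).
  have [->|w1] := eqVneq (phi h a1) a1.
    by exists 1; rewrite ?morph1 ?perm1 // inE group1.
  set w := phi h a1 in w1 *.
  have [d dD1 d2] : exists2 d, d \in D a1 & phi d a2 = w.
    have [->|w2] := eqVneq w a2; first by exists 1; rewrite ?group1 ?morph1 ?perm1.
    have [z] := @fresh_point T [:: a1; a2; w] (ltac:(by apply: leq_trans T9)).
    rewrite !inE !negb_or => /and3P[z1 z2 zw].
    have [||d dD1 phid] := @lift_family (cyc3 a2 w z) a1.
    - by apply: even_cyc3; rewrite sym.
    - by rewrite cyc3_D // sym.
    by exists d => //; rewrite phid cyc3_1 // sym.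
  by exists (t * d); [apply: (UD) | rewrite morphM ?(DG _ _ dD1) // permM t1].
have /subsetP MsU : M \subset Group gU by apply: Frattini.
case/subsetPn: (MD a1) => m mM; have := MsU m mM; rewrite inE.
case/orP=> [->//|/imset2P[c d cD dD e] _].
have [mG /eqP m1] : m \in G /\ phi m == 1 by apply/andP; rewrite -mem_kernel.
have [cG dG] := (DG _ _ cD, DG _ _ dD).
(* Elements of [D a1 * t * D a1] move [a1], whereas [M] acts trivially. *)
have : phi m a1 = a1 by rewrite m1 perm1.
rewrite e !morphM ?groupM // !permM (fixD _ _ cD) t1 -[RHS](fixD _ _ dD).
by move/perm_inj => e21; rewrite e21 eqxx in a21.
Qed.

(* [stab i / D i] is abelian, so conjugation by [y] changes [v] only in the
   coordinates that [y] moves. *)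
Lemma kernel_commg v y i :
  v \in M -> y \in G -> phi y i = i -> [~ v, y] \in D i.
Proof.
move=> vM yG yi; apply: (subsetP (Dder i)); apply: mem_commg.
  exact: (subsetP (kernel_stab i)).
by rewrite mem_stab yG yi eqxx.
Qed.

(** Call membership in [D s] triviality of the coordinate [s]. Commutators with lifts of two
    3-cycles reduce [v] to an element with nontrivial coordinate [j] and trivial coordinates outside
    [j] and one further point; conjugation then moves [j] anywhere else. *)
Lemma kernel_separation i j v : v \in M -> v \in D i -> v \notin D j ->
  exists b, forall a, a != b ->
    exists2 w, w \in M & w \notin D a /\ forall s, s != a -> s != b -> w \in D s.
Proof.
move=> vM vi vj; have ij : i != j by apply: contraNneq vj => <-.
have sym (x y : T) : x != y -> y != x by rewrite eq_sym.
have commM x y : x \in M -> y \in G -> [~ x, y] \in M.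
  move=> xM yG; have nMG : G \subset 'N(M) by rewrite -ker_phi ker_norm.
  by rewrite commgEl groupM ?groupV // memJ_norm // (subsetP nMG).
have [l] := @fresh_point T [:: i; j] (ltac:(by apply: leq_trans T9)).
rewrite !inE !negb_or => /andP[li lj].
have [u] := @fresh_point T [:: i; j; l] (ltac:(by apply: leq_trans T9)).
rewrite !inE !negb_or => /and3P[ui uj ul].
have [b] := @fresh_point T [:: i; j; l; u] (ltac:(by apply: leq_trans T9)).
rewrite !inE !negb_or => /and4P[bi bj bl bu].
have [y yG phiy] := lift_Alt (even_cyc3 ij (sym _ _ li)).
pose w := [~ v, y]; have wM : w \in M by apply: commM.
have wj : w \notin D j.
  rewrite /w commgEl groupMr ?groupV //.
  by have -> : j = phi y i; [rewrite phiy cyc3_1 // sym | rewrite familyJ].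
have wD s : s != i -> s != j -> s != l -> w \in D s.
  by move=> si sj sl; apply: kernel_commg => //; rewrite phiy cyc3_D.
have [z zG phiz] := lift_Alt (even_cyc3 (sym _ _ uj) (sym _ _ bj)).
pose x := [~ w, z]; have xM : x \in M by apply: commM.
have xj : x \notin D j.
  rewrite /x commgEl groupMr ?groupV //.
  have -> : j = phi z b by rewrite phiz cyc3_3 // sym.
  by rewrite familyJ // wD.
have xD s : s != j -> s != u -> x \in D s.
  move=> sj su; have [->|sb] := eqVneq s b; last first.
    by apply: kernel_commg => //; rewrite phiz cyc3_D.
  rewrite /x commgEl groupM ?groupV ?wD //.
  have -> : b = phi z u by rewrite phiz cyc3_2.
  by rewrite familyJ // wD.
(* The base point is [u]; [x] settles [a = j], and a lift of a 3-cycle taking [j] to [a] and fixing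
   [u] settles the rest. *)
exists u => a au; have [->|aj] := eqVneq a j; first by exists x.
have [q] := @fresh_point T [:: j; a; u] (ltac:(by apply: leq_trans T9)).
rewrite !inE !negb_or => /and3P[qj qa qu].
have [h hG phih] := lift_Alt (even_cyc3 (sym _ _ aj) (sym _ _ qj)).
have ha : phi h j = a by rewrite phih cyc3_1 // sym.
have hu : phi h u = u by rewrite phih cyc3_D // sym.
exists (x ^ h).
  have nMG : G \subset 'N(M) by rewrite -ker_phi ker_norm.
  by rewrite memJ_norm // (subsetP nMG).
split=> [|s sa su]; first by rewrite -{1}ha familyJ.
rewrite -[s](permKV (phi h)) familyJ // xD //.
  by apply: contra sa => /eqP e; rewrite -ha -e permKV.
by apply: contra su => /eqP e; rewrite -hu -e permKV.
Qed.

(* The maps [gam i] are the coordinates of the monomial action of [G] induced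
   from [stab b / D b].  Their product is the transfer, hence trivial because
   [G] is perfect, so clearing all coordinates but one by elements of [M] clears
   them all: the elements with trivial coordinates supplement [M]. *)
Lemma separated_kernel_false b :
  (forall a, a != b ->
    exists2 w, w \in M & w \notin D a /\ forall s, s != a -> s != b -> w \in D s) ->
  False.
Proof.
move=> sepM.
have sym (x y : T) : x != y -> y != x by rewrite eq_sym.
have /fin_all_exists2[g gG gb] i : exists2 h, h \in G & phi h b = i.
  have [->|ib] := eqVneq i b; first by exists 1; rewrite ?morph1 ?perm1.
  have [z] := @fresh_point T [:: i; b] (ltac:(by apply: leq_trans T9)).
  rewrite !inE !negb_or => /andP[zi zb].
  have [h hG phih] := lift_Alt (even_cyc3 (sym _ _ ib) (sym _ _ zb)).
  by exists h => //; rewrite phih cyc3_1 // sym.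
pose gam i h := g i * h * (g (phi h i))^-1.
have gamS i h : h \in G -> gam i h \in stab b.
  move=> hG; rewrite mem_stab !groupM ?groupV //= !morphM ?groupM ?groupV //.
  by rewrite morphV // !permM gb -{2}(gb (phi h i)) permK.
have gamM i h k : h \in G -> k \in G -> gam i (h * k) = gam i h * gam (phi h i) k.
  by move=> hG kG; rewrite /gam morphM // permM !mulgA mulgKV.
have gamK i m : m \in M -> (gam i m \in D b) = (m \in D i).
  rewrite mem_kernel => /andP[mG /eqP m1].
  by rewrite /gam m1 perm1 -(familyJ b _ (gG i)) gb conjgE mulgKV mulKg.
pose E := D b; have nEb := normal_norm (family_normal b).
have gamN i h : h \in G -> gam i h \in 'N(E) by move=> hG; apply/(subsetP nEb)/gamS.
have pQ : prime #|stab b / E| by rewrite card_quotient.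
have abQ : abelian (stab b / E) := cyclic_abelian (prime_cyclic pQ).
pose kap i h := coset E (gam i h).
have kapQ i h : h \in G -> kap i h \in stab b / E by move=> hG; apply/mem_quotient/gamS.
have kap1 i h : h \in G -> (kap i h == 1) = (gam i h \in E).
  by move=> hG; apply/eqP/idP => [/coset_idr -> //|/coset_id //]; apply: gamN.
have kapM i h k : h \in G -> k \in G -> kap i (h * k) = kap i h * kap (phi h i) k.
  by move=> hG kG; rewrite /kap gamM // morphM ?gamN.
pose tau h := (\sum_i FiniteModule.fmod abQ (kap i h))%R.
have tauM h k : h \in G -> k \in G -> tau (h * k) = (tau h + tau k)%R.
  move=> hG kG; rewrite /tau [X in (_ + X)%R](reindex_inj (@perm_inj _ (phi h))) -big_split /=.
  by apply: eq_bigr => i _; rewrite kapM // FiniteModule.fmodM ?kapQ.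
have tau1 : tau 1 = 0%R.
  by apply: (@addrI _ (tau 1)); rewrite -tauM // mulg1 addr0.
have tauR x y : x \in G -> y \in G -> tau [~ x, y] = 0%R.
  move=> xG yG; apply: (@addrI _ (tau y + tau x)%R).
  rewrite -tauM // -tauM ?groupM ?groupV // (_ : y * x * [~ x, y] = x * y).
    by rewrite tauM // addr0 addrC tauM.
  exact: esym (commgC x y).
have tau0 h : h \in G -> tau h = 0%R.
  have gK : group_set [set h in G | tau h == 0%R].
    apply/group_setP; split=> [|x y]; rewrite !inE ?group1 ?tau1 ?eqxx //.
    by move=> /andP[xG /eqP x0] /andP[yG /eqP y0]; rewrite groupM // tauM // x0 y0 addr0 eqxx.
  suff : G \subset Group gK by move/subsetP => GK /GK; rewrite inE => /andP[_ /eqP].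
  rewrite -{1}perfect_group gen_subG; apply/subsetP => _ /imset2P[x y xG yG ->].
  by rewrite inE groupR //=; apply/eqP/tauR.
have gU : group_set [set h in G | [forall i, gam i h \in E]].
  apply/group_setP; split=> [|x y].
    by rewrite inE group1; apply/forallP => i; rewrite gamK ?group1.
  rewrite !inE => /andP[xG /forallP xE] /andP[yG /forallP yE]; rewrite groupM //.
  by apply/forallP => i; rewrite gamM // groupM.
have UG : Group gU \subset G by apply/subsetP => h; rewrite inE => /andP[].
have clear (s : seq T) h : h \in G -> b \notin s ->
    exists2 m, m \in M & forall i, i \in s -> gam i (m * h) \in E.
  move=> hG; elim: s => [|a s IHs]; first by exists 1; rewrite ?group1.
  rewrite inE negb_or => /andP[ba bs]; have [m mM mE] := IHs bs.
  have [w wM [wa wD]] := sepM a (sym _ _ ba).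
  have [mG wG] := (subsetP kernel_sub _ mM, subsetP kernel_sub _ wM).
  have kw : kap a w != 1 by rewrite kap1 // gamK.
  (* A nontrivial element generates a group of prime order, so a power of [w] cancels the coordinate
     [a] of [m * h]; apart from [a], only the coordinate [b] can change. *)
  have kwQ : <[kap a w]> = stab b / E.
    apply/eqP; rewrite eqEcard cycle_subG kapQ //=.
    case/primeP: pQ => _ /(_ _ (order_dvdG (kapQ a w wG))).
    by rewrite order_eq1 (negPf kw) /= => /eqP <-.
  have mhG : m * h \in G by rewrite groupM.
  have : (kap a (m * h))^-1 \in <[kap a w]> by rewrite kwQ groupV kapQ.
  case/cycleP => e ke; exists (w ^+ e * m); first by rewrite groupM ?groupX.
  have fixM x i : x \in M -> phi x i = i.
    by rewrite mem_kernel => /andP[_ /eqP ->]; rewrite perm1.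
  have kX n : kap a (w ^+ n) = kap a w ^+ n.
    elim: n => [|n IHn]; last by rewrite !expgS kapM ?groupX // fixM // IHn.
    by apply/eqP; rewrite kap1 ?group1 // gamK ?group1.
  move=> i; rewrite inE -mulgA => /predU1P[->|si].
    by rewrite -kap1 ?groupM ?groupX // kapM ?groupX // fixM ?groupX // kX -ke mulVg.
  have [->|ia] := eqVneq i a.
    by rewrite -kap1 ?groupM ?groupX // kapM ?groupX // fixM ?groupX // kX -ke mulVg.
  rewrite gamM ?groupX // fixM ?groupX // groupM ?mE // gamK ?groupX // wD //.
  by apply: contraNneq bs => <-.
have MU : M * Group gU = G.
  apply/eqP; rewrite eqEsubset mul_subG ?kernel_sub //=; apply/subsetP => h hG.
  have [|m mM mE] := clear (enum (predC1 b)) h hG; first by rewrite mem_enum !inE eqxx.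
  have mG := subsetP kernel_sub _ mM; have mhG : m * h \in G by rewrite groupM.
  rewrite -(mulKg m h); apply: mem_mulg; first by rewrite groupV.
  rewrite inE mhG; apply/forallP => i.
  have mE' j : j != b -> gam j (m * h) \in E by move=> jb; apply: mE; rewrite mem_enum !inE.
  have [->|/mE' //] := eqVneq i b.
  have := tau0 _ mhG; rewrite /tau (bigD1 b) //= big1 ?addr0 => [|j jb]; last first.
    by have := mE' j jb; rewrite -kap1 // => /eqP ->; rewrite FiniteModule.fmod1.
  move/(congr1 (@FiniteModule.fmval _ _ _)); rewrite FiniteModule.fmval0 FiniteModule.fmodK ?kapQ //.
  by move/eqP; rewrite kap1.
have /subsetP MsU := Frattini UG MU.
case/subsetPn: (MD b) => m mM; have := MsU m mM; rewrite inE => /andP[_ /forallP/(_ b)].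
by rewrite gamK // => ->.
Qed.

Lemma no_coherent_family : False.
Proof.
apply: kernel_compat_false => i j; apply/subsetP => v /setIP[vM vi].
by apply: contraT => vj; have [b /separated_kernel_false] := kernel_separation vM vi vj.
Qed.

End CoherentFamily.

(** * Cores of subgroups, and nilpotency of the kernel *)

(** The action of [A] on the cosets of [S] has its kernel inside the core. *)
Lemma index_gcore_fact (gT : finGroupType) (S A : {group gT}) :
  S \subset A -> #|A : gcore S A| <= #|A : S|`!.
Proof.
move=> SA; pose R := rcosets S A.
pose to := (<[actsRs_rcosets S A]>)%act.
have kerS : 'ker (actperm to) \subset gcore S A.
  apply/subsetP => a /morphpreP[aA /set1P a1].
  rewrite -astabRs_rcosets; apply/astabP => B BR.
  have := actpermE to a B; rewrite a1 perm1 /= actbyE //= => e; rewrite [RHS]e.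
have imS : actperm to @* A \subset perm.Sym R.
  apply/subsetP => _ /morphimP[a _ aA ->]; rewrite inE; apply/subsetP => B.
  by rewrite inE actpermE /= /actby; case: ifP => [/andP[]|_ /eqP].
have := subset_leq_card imS; rewrite perm.card_Sym card_morphim setIid; apply: leq_trans.
by apply: dvdn_leq; [apply: indexg_gt0 | apply: indexgS].
Qed.

(** By the Frattini argument the normaliser of a Sylow subgroup of [M] supplements [M], hence
    contains it; so all Sylow subgroups of [M] are normal in [M]. *)
Lemma nilpotent_of_nonsupplement (gT : finGroupType) (G M : {group gT}) :
  M <| G ->
  (forall U : {group gT}, U \subset G -> M * U = G -> M \subset U) ->
  nilpotent M.
Proof.
move=> nMG Frattini; apply: nilpotentS (Fitting_nil M).
rewrite -{1}(Sylow_gen M) gen_subG; apply/bigcupsP => P /SylowP[p _ sylP].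
apply: Fitting_max (pgroup_nil (pHall_pgroup sylP)).
rewrite /normal (pHall_sub sylP).
apply: subset_trans (Frattini _ (subsetIl G 'N(P)) (Frattini_arg nMG sylP)) _.
exact: subsetIr.
Qed.

(** * The index of a subgroup not containing the kernel *)

Section Extension.

Variables (gT : finGroupType) (T : finType) (G M : {group gT}).
Variable phi : {morphism G >-> {perm T}}.
Local Notation stab := (point_preim phi).

Hypothesis T20 : 20 < #|T|.
Hypothesis phiG : phi @* G = 'Alt_T.
Hypothesis ker_phi : 'ker phi = M.
Hypothesis Frattini : forall U : {group gT}, U \subset G -> M * U = G -> M \subset U.

Lemma point_preimJ h i : h \in G -> stab i :^ h = stab (phi h i).
Proof.
move=> hG; apply/setP => x; rewrite mem_conjg !mem_stab groupJr ?groupV //.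
case xG: (x \in G) => //=; rewrite morphJ ?groupV // morphV // conjgE invgK.
by rewrite !permM -(inj_eq (@perm_inj _ (phi h))) permKV.
Qed.

Lemma kernel_normal : M <| G.
Proof. by rewrite -ker_phi ker_normal. Qed.

(** Otherwise [stab x0 / C] is a nontrivial quotient of the nilpotent group [M] and has a normal
    subgroup of prime index. The conjugates of its preimage [E] form a coherent family, which cannot
    exist. *)
Lemma normal_supplement_contains_kernel x0 (C : {group gT}) :
  C <| stab x0 -> M * C = stab x0 -> M \subset C.
Proof.
move=> nC MC; apply: contraT => MnC; exfalso.
have solM : solvable M := nilpotent_sol (nilpotent_of_nonsupplement kernel_normal Frattini).
have nMC : M \subset 'N(C) := subset_trans (kernel_stab ker_phi x0) (normal_norm nC).
have qE : stab x0 / C = M / C by rewrite -MC quotientMidr.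
have solQ : solvable (stab x0 / C) by rewrite qE quotient_sol.
have Q1 : (stab x0 / C)%G != 1 :> {set _}.
  by rewrite /= qE -subG1 quotient_sub1.
have [Cb nCb pCb] := sol_prime_factor_exists solQ Q1.
pose E := (coset C @*^-1 Cb)%G.
have CE : C \subset E by apply: sub_cosetpre.
have EqE : coset C @*^-1 (stab x0 / C) = stab x0 by rewrite quotientGK.
have nE : E <| stab x0 by rewrite -EqE cosetpre_normal.
have pE : prime #|stab x0 : E| by rewrite -EqE index_cosetpre.
have ME : ~~ (M \subset E).
  apply/negP => ME; have : stab x0 \subset E by rewrite -MC mul_subG.
  by rewrite -indexg_eq1 => /eqP e; rewrite e in pE.
have sym (x y : T) : x != y -> y != x by rewrite eq_sym.
have /fin_all_exists2[g gG gx] i : exists2 h, h \in G & phi h x0 = i.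
  have [->|ib] := eqVneq i x0; first by exists 1; rewrite ?morph1 ?perm1.
  have [z] := @fresh_point T [:: i; x0] (ltac:(by apply: leq_trans T20)).
  rewrite !inE !negb_or => /andP[zi zb].
  have [h hG phih] := lift_Alt phiG (even_cyc3 (sym _ _ ib) (sym _ _ zb)).
  by exists h => //; rewrite phih cyc3_1 // sym.
apply: (@no_coherent_family gT T G M phi (fun i => E :^ g i)%G) => //.
- exact: leq_trans T20.
- move=> h i hG /=; rewrite -conjsgM.
  (* [g i * h] and [g (phi h i)] differ by an element of [stab x0], which normalises [E]. *)
  have -> : g i * h = (g i * h * (g (phi h i))^-1) * g (phi h i) by rewrite mulgKV.
  rewrite conjsgM; congr (_ :^ _); apply: (normsP (normal_norm nE)).
  rewrite mem_stab !groupM ?groupV //= !morphM ?groupM ?groupV //.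
  by rewrite morphV // !permM gx -{2}(gx (phi h i)) permK.
- by move=> i; rewrite -{2}(gx i) -point_preimJ //= conjSg normal_sub.
- by move=> i; rewrite -{1}(gx i) -point_preimJ //= indexJg.
move=> i; apply: contra ME => MEg; rewrite -(conjSg _ _ (g i)).
by rewrite (normsP (normal_norm kernel_normal)).
Qed.

Lemma card_preim_Alt (B : {group {perm T}}) :
  B \subset 'Alt_T -> #|phi @*^-1 B| = (#|M| * #|B|)%N.
Proof. by move=> BA; rewrite card_morphpre ?phiG // ker_phi. Qed.

Lemma card_kernel_ext : (2 * #|G| = #|M| * #|T|`!)%N.
Proof.
have -> : #|G| = (#|M| * #|'Alt_T|)%N.
  by rewrite -(card_preim_Alt (B := 'Alt_T%G)) //= -phiG morphimGK // ker_phi (kernel_sub ker_phi).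
by rewrite mulnCA card_Alt // (leq_trans _ T20).
Qed.

Lemma point_preimE x : stab x = phi @*^-1 'C_('Alt_T)[x | 'P] :> {set _}.
Proof.
rewrite /= morphpreI -phiG morphimGK ?ker_phi ?(kernel_sub ker_phi) //.
by rewrite (setIidPr (morphpre_sub _ _)).
Qed.

Lemma card_others x : #|{: {y : T | y != x}}| = #|T|.-1.
Proof. by rewrite card_sig cardC1. Qed.

Lemma simple_point_stab x : simple 'C_('Alt_T)[x | 'P].
Proof. by rewrite (isog_simple (rfd_iso x)) simple_Alt5 // card_others; lia. Qed.

Lemma card_point_preim x : (2 * #|stab x| = #|M| * (#|T|.-1)`!)%N.
Proof.
rewrite point_preimE card_preim_Alt ?subsetIl // mulnCA (card_isog (rfd_iso x)).
by rewrite card_Alt card_others //; lia.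
Qed.

Lemma index_point_preim x : #|G : stab x| = #|T|.
Proof.
have sG : stab x \subset G := subsetIl _ _.
have := Lagrange sG; have := card_kernel_ext; have := card_point_preim x.
have kE : #|T| = #|T|.-1.+1 by lia.
rewrite [in #|T|`!]kE factS -kE => e1 e2 e3.
have := cardG_gt0 M; have := fact_gt0 #|T|.-1; nia.
Qed.

(** The image of the core of [S] is normal in the simple group [A_(k-1)]. If it is everything, the
    core supplements [M] in [stab x] and so contains [M]; if it is trivial, the core has index at
    least [(k-1)!/2], more than [(k-2)!]. *)
Lemma point_preim_index_bound (S : {group gT}) x :
  S \subset stab x -> ~~ (M \subset S) -> #|T| * #|T|.-1 <= #|G : S|.
Proof.
move=> Sx MS; rewrite leqNgt; apply/negP => small.
pose C := (gcore S (stab x))%G.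
have nC : C <| stab x := gcore_normal Sx.
have MC : ~~ (M \subset C) by apply: contra MS => MC; apply: subset_trans MC (gcore_sub _ _).
have phix : phi @* stab x = 'C_('Alt_T)[x | 'P].
  by rewrite point_preimE morphpreK // phiG subsetIl.
have nphiC : phi @* C <| 'C_('Alt_T)[x | 'P] by rewrite -phix morphim_normal.
have CG : C \subset G := subset_trans (normal_sub nC) (subsetIl _ _).
have [_ /(_ _ nphiC)[C1|CE]] := simpleP _ (simple_point_stab x); last first.
  case/negP: MC; apply: (@normal_supplement_contains_kernel x) => //.
  rewrite -ker_phi -morphimK //.
  have -> : phi @* C = phi @* stab x by rewrite phix -CE.
  by rewrite morphimGK ?subsetIl // ker_phi kernel_stab.
have CM : C \subset M by rewrite -ker_phi ker_trivg_morphim CG C1 /=.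
have := Lagrange_index (subsetIl G _ : stab x \subset G) Sx.
rewrite index_point_preim => eGS.
have idx : #|stab x : S| <= #|T| - 2 by nia.
have le1 : 2 * #|stab x| <= 2 * (#|M| * (#|T| - 2)`!).
  rewrite -(Lagrange (normal_sub nC)) leq_mul2l leq_mul ?subset_leq_card //.
  by rewrite (leq_trans (index_gcore_fact Sx)) ?leq_fact.
move: le1; rewrite card_point_preim (_ : #|T|.-1 = (#|T| - 2).+1); last by lia.
rewrite factS !mulnA leq_pmul2r ?fact_gt0 // (mulnC #|M|) leq_pmul2r ?cardG_gt0 //.
by lia.
Qed.

Lemma nonsupplement_index_bound (S : {group gT}) :
  S \subset G -> ~~ (M \subset S) -> #|T| * #|T|.-1 <= #|G : S|.
Proof.
move=> SG MS; rewrite leqNgt; apply/negP => small.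
have cS : #|S| = (#|S :&: M| * #|phi @* S|)%N.
  by rewrite card_morphim (setIidPr SG) ker_phi -(LagrangeI S M).
(* This factor 2 brings the index bound in the alternating group down to [k(k-1)/2]. *)
have MSM : 2 * #|S :&: M| <= #|M|.
  rewrite -(Lagrange (subsetIr S M)) mulnC leq_mul2l indexg_gt1 subsetI andbC.
  by rewrite subxx /= MS orbT.
have Ybig : #|T|`! < #|T| * #|T|.-1 * #|phi @* S|.
  apply: (@leq_ltn_trans (#|G : S| * #|phi @* S|)); last by rewrite ltn_pmul2r ?cardG_gt0.
  rewrite -(leq_pmul2l (cardG_gt0 M)) -card_kernel_ext -(Lagrange SG) cS.
  rewrite -mulnA [(_ * #|G : S|)%N]mulnC mulnA leq_mul2r.
  by apply/orP; right.
have YA : phi @* S \subset 'Alt_T by rewrite -phiG morphimS.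
have [YE|[x Sx]] := small_index_Alt T20 Ybig YA.
  case/negP: MS; apply: Frattini => //.
  rewrite -ker_phi -morphimK // YE -phiG morphimGK // ker_phi.
  exact: kernel_sub ker_phi.
have /point_preim_index_bound/(_ MS) : S \subset stab x.
  apply/subsetP => y yS; rewrite mem_stab (subsetP SG) //= Sx //.
  exact: mem_morphim (subsetP SG _ yS) yS.
by rewrite leqNgt small.
Qed.

End Extension.

(** * Reduction to a minimal supplement *)

Lemma minimal_supplement (gT : finGroupType) (H M : {group gT}) :
  M \subset H ->
  exists G : {group gT}, [/\ G \subset H, M * G = H &
    forall U : {group gT}, U \subset G -> (M :&: G) * U = G -> M :&: G \subset U].
Proof.
move=> MH; pose supp (U : {group gT}) := M * U == H.
have suppH : supp H by rewrite /supp mulSGid.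
have [G /mingroupP[/eqP MG minG] GH] := mingroup_exists suppH.
exists G; split=> // U UG MU.
have UE : U :=: G.
  (* A supplement [U] of [M :&: G] in [G] also supplements [M] in [H], so minimality gives
     [U = G]. *)
  by apply: minG => //; rewrite /supp -MG -[in eqbRHS]MU mulgA (mulGSid (subsetIl M G)).
by rewrite UE subsetIr.
Qed.

Lemma index_perm_stab (gT : finGroupType) (l : nat) (G H : {group gT})
    (f : {morphism H >-> {perm 'I_l}}) (d : 'I_l) :
  'injm f -> G \subset H -> #|G : G :&: f @*^-1 'C[d | 'P]| <= l.
Proof.
move=> injf GH; rewrite -[leqRHS]card_ord -(index_injm _ injf GH) morphim_setIpre.
by rewrite -card_orbit max_card.
Qed.

Lemma extension_restriction (gT rT : finGroupType) (H M G : {group gT}) (A : {group rT}) :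
  M <| H -> (H / M) \isog A -> G \subset H -> M * G = H ->
  exists2 phi : {morphism G >-> rT}, phi @* G = A & 'ker phi = M :&: G.
Proof.
move=> nMH /isogP[psi injpsi psiH] GH MG.
have sGD : G \subset coset M @*^-1 (H / M) by rewrite quotientGK.
exists [morphism of restrm sGD (psi \o coset M)].
  have GM : G / M = H / M by rewrite -[in RHS]MG quotientMidl.
  by rewrite morphim_restrm setIid morphim_comp -quotientE GM.
rewrite ker_restrm ker_comp (trivgP injpsi) -/('ker (coset M)).
by rewrite ker_coset setIC.
Qed.

Theorem theorem1p1 (k : nat) (gT : finGroupType) (H M : {group gT}) (l : nat) :
  20 < k ->
  M <| H ->
  M :!=: 1 ->
  (H / M) \isog ('Alt_('I_k)) ->
  ~~ [splits H, over M] ->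
  (exists f : {morphism H >-> {perm 'I_l}}, 'injm f) ->
  k * (k - 1) <= l.
Proof.
move=> k20 nMH _ isoA nsplit [f injf].
have [G [GH MG Frattini]] := minimal_supplement (normal_sub nMH).
have [phi phiG kerphi] := extension_restriction nMH isoA GH MG.
(* A supplement meeting [M] trivially would be a complement. *)
have ntMG : M :&: G != 1.
  by apply: contra nsplit => /eqP MG1; apply/splitsP; exists G; apply/complP.
have [m mMG m1] := trivgPn _ ntMG.
have mG := subsetP (subsetIr M G) _ mMG; have mH := subsetP GH _ mG.
have fm1 : f m != 1 by rewrite (morph_injm_eq1 injf).
have [d fmd|fm_id] := pickP (fun d => f m d != d); last first.
  by case/eqP: fm1; apply/permP => d; rewrite perm1; apply/eqP/negbFE/fm_id.
apply: leq_trans (index_perm_stab d injf GH).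
rewrite subn1 -[k]card_ord.
apply: (nonsupplement_index_bound (M := (M :&: G)%G) (phi := phi)) => //.
- by rewrite card_ord.
- exact: subsetIl.
apply: contra fmd => /subsetP/(_ m mMG)/setIP[_ /morphpreP[_ /astab1P e]].
by rewrite -{2}e.
Qed.
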